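(* Let $F_2$ be the free group with free basis $\{x_1,x_2\}$, let $u\in F_2$, $u\neq 1$, and let $O_{\mathrm{Aut}\,F_2}(u)=\{\alpha(u):\alpha\in \mathrm{Aut}\,F_2\}$ be its automorphic orbit. If an endomorphism $\phi$ of $F_2$ preserves this orbit, i.e. $\phi(O_{\mathrm{Aut}\,F_2}(u))\subseteq O_{\mathrm{Aut}\,F_2}(u)$, then $\phi$ is an automorphism of $F_2$. *)

(* Defs.v *)
From mathcomp Require Import all_boot.
Set Implicit Arguments. Unset Strict Implicit. Unset Printing Implicit Defensive.

(* A letter (g, e): g = false is x1, g = true is x2; e = true means inverse. *)
Definition letter := (bool * bool)%type.
Definition linv (a : letter) : letter := (a.1, ~~ a.2).

Definition reduced (w : seq letter) : bool :=
  if w is a :: t then path (fun x y => y != linv x) a t else true.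

Definition push (a : letter) (s : seq letter) : seq letter :=
  if s is b :: s' then (if b == linv a then s' else a :: s) else [:: a].

Definition red (w : seq letter) : seq letter := foldr push [::] w.

Lemma push_reduced a s : reduced s -> reduced (push a s).
Proof.
case: s => [|b s'] //= H.
case: ifP => Hb /=.
  by case: s' H => [|c t] //= /andP [].
by rewrite Hb H.
Qed.

Lemma red_reduced w : reduced (red w).
Proof. by elim: w => [|a w IH] //=; apply: push_reduced. Qed.

Definition F2 := {w : seq letter | reduced w}.

Definition F2one : F2 := exist _ [::] isT.
Definition F2mul (x y : F2) : F2 :=
  exist _ (red (proj1_sig x ++ proj1_sig y)) (red_reduced _).

Definition is_endo (f : F2 -> F2) : Prop :=
  forall x y, f (F2mul x y) = F2mul (f x) (f y).

Definition is_aut (f : F2 -> F2) : Prop := is_endo f /\ bijective f.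

Definition aut_orbit (u : F2) : F2 -> Prop :=
  fun v => exists alpha, is_aut alpha /\ v = alpha u.

(* Main.v *)
(* Measure an element by its cyclically reduced length, a conjugacy invariant.  Up to
   Nielsen moves and conjugation, a pair (c, d) either has a trivial entry, or consists of
   letters on distinct generators, or labels an immersed rose, barbell or theta graph with
   more than two edges.  In the graph case the endomorphism x1 -> c, x2 -> d strictly
   lengthens every cyclic word, except possibly powers of primitive elements.  Composing
   phi with an automorphism so that phi(u) has minimal cyclic length in the orbit thus
   leaves, when u is not a power of a primitive element, only automorphisms (a trivial
   entry is excluded because the Euclidean algorithm makes the second exponent sum of u
   vanish).

   For powers of primitive elements, positive words show that the cyclic length of a
   primitive element is the l1 norm of its abelianization.  One reduces to
   phi(x1) = x1 and phi(x2) = g x2 g^-1 with g trimmed; then phi(x1 x2) has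
   abelianization (1, 1), hence cyclic length 2, which forces g = 1. *)
Require Import Defs.
From HB Require Import structures.
From mathcomp Require Import all_boot all_order all_algebra zify.
From Stdlib Require Import Classical.
Set Implicit Arguments. Unset Strict Implicit. Unset Printing Implicit Defensive.
Local Open Scope group_scope.

Implicit Types (l m : letter) (s t : seq letter).

(** * The group structure on reduced words *)

Lemma linvK : involutive linv.
Proof. by case=> g e; rewrite /linv /= negbK. Qed.

Lemma linv_neq l : (linv l == l) = false.
Proof. by case: l => [[] []]. Qed.

Lemma eq_linv l m : (linv l == m) = (l == linv m).
Proof. by case: l m => [[] []] [[] []]. Qed.

Definition nocancel l m := m != linv l.

Lemma nocancelV l m : nocancel (linv m) (linv l) = nocancel l m.
Proof. by case: l m => [[] []] [[] []]. Qed.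

Lemma reduced_sorted s : reduced s = sorted nocancel s.
Proof. by case: s. Qed.

(** Each letter acts on reduced words as a permutation (van der Waerden's argument); associativity
    of [F2mul] rests on this. *)
Lemma push_linvK l s : reduced s -> push l (push (linv l) s) = s.
Proof.
case: s => [|m s] /= Hs; first by rewrite eqxx.
rewrite linvK; case: eqP Hs => [->|_] Hs /=; last by rewrite eqxx.
by case: s Hs => //= k s /andP[/negbTE ->].
Qed.

Lemma red_push l s t : reduced s -> red (push l s ++ t) = push l (red (s ++ t)).
Proof.
case: s => [|m s] //= Hs; case: eqP => [->|_] //=.
by rewrite push_linvK // red_reduced.
Qed.

Lemma red_catl s t : red (red s ++ t) = red (s ++ t).
Proof. by elim: s => //= l s IH; rewrite red_push ?red_reduced // IH. Qed.

Lemma red_catr s t : red (s ++ red t) = red (s ++ t).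
Proof.
suff redK : red (red t) = red t by elim: s => //= l s ->.
by have := red_catl t [::]; rewrite !cats0.
Qed.

Lemma reduced_red s : reduced s -> red s = s.
Proof.
elim: s => //= l s IH Hs.
have {IH}-> : red s = s by apply: IH; rewrite reduced_sorted; apply: path_sorted Hs.
by case: s Hs => //= m s /andP[/negbTE ->].
Qed.

Definition swinv s : seq letter := rev (map linv s).

Lemma size_swinv s : size (swinv s) = size s.
Proof. by rewrite size_rev size_map. Qed.

Lemma swinvK : involutive swinv.
Proof. by move=> s; rewrite /swinv map_rev revK mapK //; apply: linvK. Qed.

Lemma swinv_neq0 s : s <> [::] -> swinv s <> [::].
Proof. by move=> s0 /(congr1 swinv); rewrite swinvK. Qed.

Lemma swinv_cat s t : swinv (s ++ t) = swinv t ++ swinv s.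
Proof. by rewrite /swinv map_cat rev_cat. Qed.

Lemma swinv_cons l s : swinv (l :: s) = rcons (swinv s) (linv l).
Proof. by rewrite /swinv /= rev_cons. Qed.

Lemma swinv_rcons l s : swinv (rcons s l) = linv l :: swinv s.
Proof. by rewrite /swinv map_rcons rev_rcons. Qed.

Lemma sorted_swinv s : sorted nocancel (swinv s) = sorted nocancel s.
Proof.
rewrite /swinv rev_sorted sorted_map; apply: eq_sorted => l m /=.
by rewrite nocancelV.
Qed.

Lemma red_mulV s : red (swinv s ++ s) = [::].
Proof.
elim: s => //= l s IH; rewrite swinv_cons cat_rcons -red_catr /=.
have := @push_linvK (linv l) (red s) (red_reduced s); rewrite linvK => ->.
by rewrite red_catr.
Qed.

Definition wd s : F2 := exist _ (red s) (red_reduced s).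

Definition F2inv (x : F2) : F2 := wd (swinv (val x)).

HB.instance Definition _ := Choice.copy F2 {w : seq letter | reduced w}.

Fact F2mulA : associative F2mul.
Proof. by move=> x y z; apply: val_inj; rewrite /= red_catl red_catr catA. Qed.

Fact F2mul1 : left_id F2one F2mul.
Proof. by move=> x; apply: val_inj; rewrite /= reduced_red //; apply: valP. Qed.

Fact F2mulr1 : right_id F2one F2mul.
Proof. by move=> x; apply: val_inj; rewrite /= cats0 reduced_red //; apply: valP. Qed.

Fact F2mulV : left_inverse F2one F2inv F2mul.
Proof. by move=> x; apply: val_inj; rewrite /= red_catl red_mulV. Qed.

Fact F2mulrV : right_inverse F2one F2inv F2mul.
Proof.
by move=> x; apply: val_inj; rewrite /= red_catr -{1}[proj1_sig x]swinvK red_mulV.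
Qed.

HB.instance Definition _ :=
  isGroup.Build F2 F2mulA F2mul1 F2mulr1 F2mulV F2mulrV.

Implicit Types (x y z g : F2).

Lemma wd_val x : wd (val x) = x.
Proof. by apply: val_inj; rewrite /= reduced_red //; apply: valP. Qed.

Lemma wd_cat s t : wd (s ++ t) = wd s * wd t.
Proof. by apply: val_inj; rewrite /= red_catl red_catr. Qed.

Lemma wd0 : wd [::] = 1. Proof. exact: val_inj. Qed.

Definition gl l : F2 := wd [:: l].

Lemma wd_cons l s : wd (l :: s) = gl l * wd s.
Proof. by rewrite -cat1s wd_cat. Qed.

Lemma wd_rcons l s : wd (rcons s l) = wd s * gl l.
Proof. by rewrite -cats1 wd_cat. Qed.

Lemma wd_swinv s : wd (swinv s) = (wd s)^-1.
Proof.
apply/eqP; rewrite -mulg_eq1 -wd_cat; apply/eqP/val_inj.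
by rewrite /= red_mulV.
Qed.

Lemma gl_linv l : gl (linv l) = (gl l)^-1.
Proof. by rewrite -wd_swinv. Qed.

Lemma val_wd_reduced s : sorted nocancel s -> val (wd s) = s.
Proof. by rewrite -reduced_sorted /=; apply: reduced_red. Qed.

Lemma val_reduced x : sorted nocancel (val x).
Proof. by rewrite -reduced_sorted; apply: (valP x). Qed.

Lemma wd_flatten_nseq n s : wd (flatten (nseq n s)) = wd s ^+ n.
Proof. by elim: n => [|n IH]; rewrite ?wd0 //= wd_cat IH expgS. Qed.

Definition len x := size (val x).

Lemma size_push l s : size (push l s) <= (size s).+1.
Proof. by case: s => //= m s; case: ifP => //= _; rewrite !leqW. Qed.

Lemma size_red s : size (red s) <= size s.
Proof. by elim: s => //= l s IH; apply: leq_trans (size_push _ _) _. Qed.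

Lemma len_wd s : len (wd s) <= size s.
Proof. exact: size_red. Qed.

Lemma len_wd_reduced s : sorted nocancel s -> len (wd s) = size s.
Proof. by move=> Hs; rewrite /len val_wd_reduced. Qed.

(** A cancellation loses letters, so equal lengths exclude it; minimality of lengths is turned into
    reducedness this way. *)
Lemma len_wd_eq s : len (wd s) = size s -> sorted nocancel s.
Proof.
elim: s => // l s IH; rewrite /len /= => Hs.
have Hsz : size (red s) = size s.
  by apply/eqP; rewrite eqn_leq size_red -ltnS -Hs size_push.
have Hsr := IH Hsz; rewrite (reduced_red (s := s)) ?reduced_sorted // in Hs.
case: s Hs Hsr {IH Hsz} => //= m s; rewrite /nocancel.
by case: eqP => //= _ Hs; exfalso; lia.
Qed.

Lemma lenM x y : len (x * y) <= len x + len y.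
Proof. by rewrite -size_cat; apply: size_red. Qed.

Lemma lenV x : len x^-1 = len x.
Proof.
rewrite -[in LHS](wd_val x) -wd_swinv len_wd_reduced ?size_swinv //.
by rewrite sorted_swinv val_reduced.
Qed.

Lemma lenJ x g : len (x ^ g) <= len x + (len g).*2.
Proof.
rewrite conjgE; apply: leq_trans (lenM _ _) _; rewrite lenV.
rewrite -addnn addnCA leq_add2l; exact: lenM.
Qed.

(** * Cyclically reduced words *)

Definition cycred c := cycle nocancel c.

Lemma sorted_cat_path (T : Type) (e : rel T) a (s t : seq T) :
  path e a (s ++ t) -> path e a s.
Proof. by rewrite cat_path => /andP[]. Qed.

Lemma cycle_sorted (T : Type) (e : rel T) (s : seq T) : cycle e s -> sorted e s.
Proof. by case: s => //= a s; rewrite -cats1; apply: sorted_cat_path. Qed.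

Lemma cycle_flatten_nseq (T : Type) (e : rel T) n (s : seq T) :
  cycle e s -> cycle e (flatten (nseq n s)).
Proof.
case: s => [|a s] He; first by elim: n.
case: n => //= n; elim: n => [|n IH] /=; first by rewrite cats0.
by rewrite rcons_cat rcons_cons -cat_rcons cat_path last_rcons IH andbT.
Qed.

Lemma len_cycredX n c : cycred c -> len (wd c ^+ n) = (n * size c)%N.
Proof.
move=> Hc; rewrite -wd_flatten_nseq len_wd_reduced.
  by rewrite size_flatten /shape map_nseq sumn_nseq mulnC.
exact/cycle_sorted/cycle_flatten_nseq.
Qed.

(* The cyclically reduced length is the growth rate of |x^n|, hence a conjugacy invariant. *)
Lemma cycred_conj_leq c d g :
  cycred c -> cycred d -> wd c = wd d ^ g -> (size c <= size d)%N.
Proof.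
move=> Hc Hd E; rewrite leqNgt; apply/negP => Hlt.
(* The exponent exceeds [2 * len g], so a gap of one letter per factor outweighs the fixed cost of
   conjugation. *)
have := lenJ (wd d ^+ (len g).*2.+1) g.
rewrite conjXg -E !len_cycredX //.
by move: (len g) Hlt => n Hlt; nia.
Qed.

Lemma cycred_conj c d g :
  cycred c -> cycred d -> wd c = wd d ^ g -> size c = size d.
Proof.
move=> Hc Hd E; apply/eqP; rewrite eqn_leq (cycred_conj_leq Hc Hd E) /=.
by apply: (@cycred_conj_leq _ _ g^-1) => //; rewrite E conjgK.
Qed.

(** Peel off the outer letters while they are mutually inverse; the core is nonempty since a letter
    and its inverse are never adjacent in a reduced word. *)
Lemma reduced_cycred s : sorted nocancel s ->
  exists k c : seq letter, [/\ s = k ++ c ++ swinv k, cycred c & s != [::] -> c != [::]].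
Proof.
have [n] := ubnP (size s); elim: n s => // n IH [|a s] Hn Hs.
  by exists [::], [::].
case: (lastP s) Hs Hn => [|t b] Hs Hn.
  by exists [::], [:: a]; rewrite /cycred /= /nocancel eq_sym linv_neq.
have [Eb|Nb] := eqVneq b (linv a); last first.
  exists [::], (a :: rcons t b); rewrite cats0; split=> //.
  rewrite /cycred /= rcons_path; move: (Hs) => /= -> /=; rewrite last_rcons.
  by rewrite /nocancel -eq_linv eq_sym.
have Ht : sorted nocancel t.
  apply: (@path_sorted _ _ a); apply: (@sorted_cat_path _ _ _ _ [:: b]).
  by rewrite cats1.
have Nt : t != [::] by case: t Hs {Hn Ht} => //=; rewrite Eb /nocancel eqxx.
have [|g [c [E1 E2 E3]]] := IH t _ Ht; first by move: Hn; rewrite /= size_rcons; lia.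
exists (a :: g), c; split=> //; last by rewrite E3.
by rewrite swinv_cons Eb {1}E1 /= -!cats1 -!catA.
Qed.

Lemma wd_conj s (c : seq letter) : wd (s ++ c ++ swinv s) = wd c ^ (wd s)^-1.
Proof. by rewrite !wd_cat wd_swinv conjgE invgK. Qed.

Lemma cycred_rep x : exists c g, cycred c /\ x = wd c ^ g.
Proof.
have [g [c [E Hc _]]] := reduced_cycred (val_reduced x).
by exists c, (wd g)^-1; rewrite -wd_conj -E wd_val.
Qed.

(** * Endomorphisms and Nielsen moves *)

Definition gx := gl (false, false).
Definition gy := gl (true, false).

Definition ev (a b : F2) l : F2 :=
  let z := if l.1 then b else a in if l.2 then z^-1 else z.

Definition evs a b s : F2 := foldr (fun l z => ev a b l * z) 1 s.

Definition hom a b x := evs a b (val x).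

Lemma ev_linv a b l : ev a b (linv l) = (ev a b l)^-1.
Proof. by case: l => [g []]; rewrite /ev /= ?invgK. Qed.

Lemma evs_cat a b s t : evs a b (s ++ t) = evs a b s * evs a b t.
Proof. by elim: s => [|l s IH] /=; rewrite ?mul1g // IH mulgA. Qed.

Lemma evs_push a b l s : evs a b (push l s) = ev a b l * evs a b s.
Proof.
case: s => //= m s; case: eqP => //= ->.
by rewrite ev_linv mulVKg.
Qed.

Lemma hom_wd a b s : hom a b (wd s) = evs a b s.
Proof.
rewrite /hom /=; elim: s => //= l s IH.
by rewrite evs_push IH.
Qed.

Lemma hom_gl a b l : hom a b (gl l) = ev a b l.
Proof. by rewrite hom_wd /= mulg1. Qed.

Lemma hom_gx a b : hom a b gx = a. Proof. by rewrite hom_gl. Qed.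
Lemma hom_gy a b : hom a b gy = b. Proof. by rewrite hom_gl. Qed.

Lemma hom_endo a b : is_endo (hom a b).
Proof.
move=> x y; have -> : F2mul x y = wd (val x ++ val y) by rewrite wd_cat !wd_val.
by rewrite hom_wd evs_cat.
Qed.

Section Endo.
Variables (f : F2 -> F2) (Ef : is_endo f).

Lemma endoM x y : f (x * y) = f x * f y. Proof. exact: Ef. Qed.

Lemma endo1 : f 1 = 1.
Proof. by apply: (mulgI (f 1)); rewrite -endoM !mulg1. Qed.

Lemma endoV x : f x^-1 = (f x)^-1.
Proof. by apply: (mulgI (f x)); rewrite -endoM !mulgV endo1. Qed.

Lemma endoJ x g : f (x ^ g) = f x ^ f g.
Proof. by rewrite !conjgE !endoM endoV. Qed.

Lemma endoX x n : f (x ^+ n) = f x ^+ n.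
Proof. by elim: n => [|n IH]; rewrite ?expg0 ?endo1 // !expgS endoM IH. Qed.

Lemma endo_hom : f =1 hom (f gx) (f gy).
Proof.
move=> x; rewrite -(wd_val x) hom_wd; elim: (val x) => [|l s IH] /=.
  by rewrite wd0 endo1.
rewrite wd_cons endoM IH; congr (_ * _); by case: l => [[] []]; rewrite /ev //= -endoV -gl_linv.
Qed.

End Endo.

Lemma endo_ext f h : is_endo f -> is_endo h ->
  f gx = h gx -> f gy = h gy -> f =1 h.
Proof.
by move=> Ef Eh E1 E2 x; rewrite (endo_hom Ef) (endo_hom Eh) E1 E2.
Qed.

Lemma endo_comp f h : is_endo f -> is_endo h -> is_endo (f \o h).
Proof. by move=> Ef Eh x y /=; rewrite Eh Ef. Qed.

Lemma endo_conj g : is_endo (conjg^~ g).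
Proof. by move=> x y; exact: conjMg. Qed.

Lemma hom_id : hom gx gy =1 id.
Proof. by apply: endo_ext => //; rewrite ?hom_gx ?hom_gy //; apply: hom_endo. Qed.

Lemma hom_comp a b p q x : hom a b (hom p q x) = hom (hom a b p) (hom a b q) x.
Proof.
apply: (endo_ext (f := hom a b \o hom p q)) => /=; rewrite ?hom_gx ?hom_gy //.
  by apply: endo_comp; apply: hom_endo.
exact: hom_endo.
Qed.

Lemma aut_comp f h : is_aut f -> is_aut h -> is_aut (f \o h).
Proof.
by move=> [Ef Bf] [Eh Bh]; split; [apply: endo_comp | apply: bij_comp].
Qed.

Lemma aut_ext f h : f =1 h -> is_aut f -> is_aut h.
Proof.
move=> E [Ef Bf]; split; last exact: eq_bij Bf _ E.
by move=> x y; rewrite -!E Ef.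
Qed.

Lemma aut_conj g : is_aut (conjg^~ g).
Proof.
split; first exact: endo_conj.
by exists (conjg^~ g^-1) => x; rewrite ?conjgK ?conjgKV.
Qed.

Lemma aut_inv f : is_aut f -> exists2 h, is_aut h & cancel f h /\ cancel h f.
Proof.
move=> [Ef [h fK hK]]; exists h => //; split; last by exists f.
by move=> x y; apply: (can_inj fK); rewrite Ef !hK.
Qed.

Lemma hom_aut a b c d : hom a b c = gx -> hom a b d = gy ->
  hom c d a = gx -> hom c d b = gy -> is_aut (hom a b).
Proof.
move=> E1 E2 E3 E4; split; first exact: hom_endo.
by exists (hom c d) => x; rewrite hom_comp ?E1 ?E2 ?E3 ?E4 hom_id.
Qed.

Lemma orbit_aut u f v : is_aut f -> aut_orbit u v -> aut_orbit u (f v).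
Proof.
move=> Af [h [Ah ->]]; exists (f \o h); split=> //; exact: aut_comp.
Qed.

Lemma aut_id : is_aut id. Proof. by split=> //; exists id. Qed.

Lemma orbit_refl u : aut_orbit u u.
Proof. by exists id; split=> //; apply: aut_id. Qed.

Lemma orbit_sym u v : aut_orbit u v -> aut_orbit v u.
Proof.
move=> [h [Ah ->]]; have [k Ak [hK _]] := aut_inv Ah.
by exists k; rewrite hK.
Qed.

Lemma orbit_trans u v w : aut_orbit u v -> aut_orbit v w -> aut_orbit u w.
Proof. by move=> Huv [h [Ah ->]]; apply: orbit_aut. Qed.

(** Simultaneous conjugation is included so that the base point of the graph labelled by a pair can
    be moved. *)
Inductive nielsen (a b : F2) : F2 -> F2 -> Prop :=
| Nrefl : nielsen a b a b
| Nswap c d : nielsen a b c d -> nielsen a b d c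
| Ninv c d : nielsen a b c d -> nielsen a b c^-1 d
| Nmul c d : nielsen a b c d -> nielsen a b (c * d) d
| Nconj c d g : nielsen a b c d -> nielsen a b (c ^ g) (d ^ g).

Lemma Ntrans a b c d e f : nielsen a b c d -> nielsen c d e f -> nielsen a b e f.
Proof.
move=> H; elim=> {e f} // *; by [apply: Nswap|apply: Ninv|apply: Nmul|apply: Nconj].
Qed.

Lemma Ninvr a b c d : nielsen a b c d -> nielsen a b c d^-1.
Proof. by move=> /Nswap/Ninv/Nswap. Qed.

Lemma NmulV a b c d : nielsen a b c d -> nielsen a b (c / d) d.
Proof. by move=> /Ninvr/Nmul/Ninvr; rewrite invgK. Qed.

Lemma Nsym a b c d : nielsen a b c d -> nielsen c d a b.
Proof.
elim=> {c d} [|c d _|c d _|c d _|c d g _]; first exact: Nrefl.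
- by apply: Ntrans; apply/Nswap/Nrefl.
- by apply: Ntrans; rewrite -{2}(invgK c); apply/Ninv/Nrefl.
- by apply: Ntrans; rewrite -{2}(mulgK d c); apply/NmulV/Nrefl.
- apply: Ntrans; rewrite -{2}(conjgK g c) -{2}(conjgK g d); exact/Nconj/Nrefl.
Qed.

Lemma aut_swap : is_aut (hom gy gx).
Proof. by apply: (hom_aut (c := gy) (d := gx)); rewrite ?hom_gx ?hom_gy. Qed.

Lemma aut_inv1 : is_aut (hom gx^-1 gy).
Proof.
apply: (hom_aut (c := gx^-1) (d := gy)); rewrite ?hom_gy //;
by rewrite (endoV (hom_endo _ _)) hom_gx invgK.
Qed.

Lemma aut_mul : is_aut (hom (gx * gy) gy).
Proof.
apply: (hom_aut (c := gx / gy) (d := gy)); rewrite ?hom_gy //.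
  by rewrite !(endoM (hom_endo _ _)) (endoV (hom_endo _ _)) hom_gx hom_gy mulgK.
by rewrite !(endoM (hom_endo _ _)) hom_gx hom_gy mulgVK.
Qed.

(** Swap, inversion and multiplication precompose [hom] with an automorphism; conjugation
    postcomposes it with an inner one. *)
Lemma nielsen_aut a b c d : nielsen a b c d ->
  exists2 beta, is_aut beta & exists g, forall w, hom c d w = hom a b (beta w) ^ g.
Proof.
have comp p q f : is_aut f ->
    (exists2 beta, is_aut beta & exists g, forall w, hom p q w = hom a b (beta w) ^ g) ->
    exists2 beta, is_aut beta &
      exists g, forall w, hom p q (f w) = hom a b (beta w) ^ g.
  move=> Af [beta Ab [g E]]; exists (beta \o f); first exact: aut_comp.
  by exists g => w /=; rewrite E.
elim=> {c d} [|c d _|c d _|c d _|c d h _].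
- by exists id; [apply: aut_id | exists 1 => w; rewrite conjg1].
- move=> /(comp _ _ _ aut_swap)[beta Ab [g E]]; exists beta => //; exists g => w.
  by rewrite -E hom_comp hom_gx hom_gy.
- move=> /(comp _ _ _ aut_inv1)[beta Ab [g E]]; exists beta => //; exists g => w.
  by rewrite -E hom_comp (endoV (hom_endo _ _)) hom_gx hom_gy.
- move=> /(comp _ _ _ aut_mul)[beta Ab [g E]]; exists beta => //; exists g => w.
  by rewrite -E hom_comp (endoM (hom_endo _ _)) hom_gx hom_gy.
- move=> [beta Ab [g E]]; exists beta => //; exists (g * h) => w.
  rewrite conjgM -E; apply: (endo_ext (h := conjg^~ h \o hom c d)) => /=.
  + exact: hom_endo.
  + by apply: endo_comp (endo_conj _) (hom_endo _ _).
  + by rewrite !hom_gx.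
  + by rewrite !hom_gy.
Qed.

(** * Immersed graphs *)

Lemma sorted_catl (T : Type) (e : rel T) (s t : seq T) : sorted e (s ++ t) -> sorted e s.
Proof. by case: s => //= a s; rewrite cat_path => /andP[]. Qed.

Lemma sorted_catr (T : Type) (e : rel T) (s t : seq T) : sorted e (s ++ t) -> sorted e t.
Proof.
elim: s => //= a s IH Hs; apply: IH.
exact: path_sorted Hs.
Qed.

Lemma sorted_glue (T : Type) (e : rel T) (s t u : seq T) : t <> [::] ->
  sorted e (s ++ t) -> sorted e (t ++ u) -> sorted e (s ++ t ++ u).
Proof.
case: t => // b t _; case: s => //= a s; rewrite !cat_path /= => Hs.
by rewrite cat_path => Ht; move: Hs Ht => /and3P[-> -> _].
Qed.

Lemma sorted_glue1 s t l m : nocancel l m -> sorted nocancel (rcons s l) ->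
  sorted nocancel (m :: t) -> sorted nocancel (rcons s l ++ m :: t).
Proof.
move=> Hlm Hs Ht; rewrite -cats1 -catA; apply: sorted_glue; rewrite ?cats1 //.
by rewrite /= Hlm.
Qed.

Lemma sorted_swinv_cat s t :
  sorted nocancel (s ++ t) -> sorted nocancel (swinv t ++ swinv s).
Proof. by rewrite -swinv_cat sorted_swinv. Qed.

(* The two shapes of cyclic words that can represent a power of a primitive element
   without being lengthened by a subdivided rose or theta graph. *)
Definition powerlike w :=
  cycle (fun l m => l.1 == m.1) w || cycle (fun l m => l.2 != m.2) w.

(** [size z] is the cyclic length of the image of [w]. The equality case must allow powers: a
    one-letter loop of a rose keeps the length of its powers. *)
Definition expanding a b := forall w : seq letter, w <> [::] -> cycred w ->
  exists (z : seq letter) g, [/\ cycred z, wd z = hom a b (wd w) ^ g,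
    size w <= size z & size w = size z -> powerlike w].

(* An immersed graph: [mid l] labels the middle part of the loop [l], [junc l m] the
   path joining the middle parts of consecutive loops, and [h l] the path from
   the base point to the start of [mid l]. *)
Section Immersion.
Variables (a b : F2) (mid : letter -> seq letter).
Variables (junc : letter -> letter -> seq letter) (h : letter -> F2).
Hypothesis mid0 : forall l, mid l <> [::].
Hypothesis immersed : forall l m, nocancel l m ->
  sorted nocancel (mid l ++ junc l m ++ mid m).
Hypothesis ev_mid : forall l, ev a b l = h l * wd (mid l) * (h (linv l))^-1.
Hypothesis wd_junc : forall l m, nocancel l m ->
  wd (junc l m) = (h (linv l))^-1 * h m.

Let hd l := head l (mid l).
Let tm l := behead (mid l).
(** Runs from just after the first letter of [mid l] to just after that of [mid m], so consecutive
    pieces fit together and none is empty. *)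
Let rest l m := rcons (tm l ++ junc l m) (hd m).
Let image l s := flatten (pairmap rest l s).

Let midE l : mid l = hd l :: tm l.
Proof. by rewrite /hd /tm; case: (mid l) (@mid0 l). Qed.

Let path_rest l m : nocancel l m -> path nocancel (hd l) (rest l m).
Proof.
move=> /immersed; rewrite (midE l) (midE m) /= catA -cat_rcons.
exact: sorted_cat_path.
Qed.

Let path_image l s : path nocancel l s ->
  path nocancel (hd l) (image l s) /\ last (hd l) (image l s) = hd (last l s).
Proof.
elim: s l => //= m s IH l /andP[Hlm /IH[Hp Hl]].
by rewrite /image /= cat_path last_cat last_rcons path_rest.
Qed.

Let base l := h l * gl (hd l).

Let wd_image l s : path nocancel l s ->
  wd (image l s) = (base l)^-1 * evs a b (belast l s) * base (last l s).
Proof.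
elim: s l => [|m s IH] l /=; first by rewrite wd0 mulg1 mulVg.
move=> /andP[Hlm /IH E]; rewrite /image /= wd_cat [wd (flatten _)]E.
suff -> : wd (rest l m) = (base l)^-1 * ev a b l * base m.
  by move: (base l) (base m) (base _) => x y z; rewrite !mulgA mulgK.
rewrite wd_rcons wd_cat wd_junc // ev_mid midE wd_cons /base.
by rewrite invgM !mulgA mulgVK mulVg mul1g.
Qed.

Let size_image l s : size s <= size (image l s) /\
  (size s = size (image l s) -> path (fun l m => tm l ++ junc l m == [::]) l s).
Proof.
elim: s l => // m s IH l; have [H1 H2] := IH m.
have -> : size (image l (m :: s)) = (size (tm l ++ junc l m)).+1 + size (image m s).
  by rewrite {1}/image /= size_cat size_rcons.
move: (size (image m s)) H1 H2 => n H1 H2 /=; split; first by lia.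
move=> E; have [/size0nil -> /H2 -> //] : size (tm l ++ junc l m) = 0 /\ size s = n.
by move: (size (_ ++ _)) (size s) E H1 => i j E H1; lia.
Qed.

(** Following the loops along a cyclic word gives a closed path without backtracking, to which every
    letter of the word contributes at least one letter. *)
Lemma immersion_expanding :
  (forall w : seq letter, w <> [::] -> cycred w ->
    cycle (fun l m => behead (mid l) ++ junc l m == [::]) w -> powerlike w) ->
  expanding a b.
Proof.
move=> Hpow [|l s] // _ Hc; have := Hc; rewrite /cycred /= => Hp.
have [Hi Hl] := path_image Hp; have Ew := wd_image Hp.
have [Hs1 Hs2] := size_image l (rcons s l).
move: Hi Hl Ew Hs1 Hs2; case: (lastP (image l (rcons s l))).
  by rewrite size_rcons.
move=> z m Hi; rewrite !last_rcons belast_rcons => Em.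
rewrite {}Em in Hi *; move=> Ew Hs1 Hs2.
(* The closed path ends with the first letter of [mid l], which is rotated to the front. *)
exists (hd l :: z), (h l); split=> //.
- have -> : wd (hd l :: z) = gl (hd l) * wd (rcons z (hd l)) * (gl (hd l))^-1.
    by rewrite wd_cons wd_rcons mulgA mulgK.
  by rewrite Ew hom_wd /base invgM conjgE !mulgA mulgV mul1g mulgK.
- by move: Hs1; rewrite !size_rcons.
- by move=> E; apply: Hpow => //; apply: Hs2; move: E; rewrite !size_rcons.
Qed.

End Immersion.

(** Theta graph with edges [p], [q], [r]. The edge [r] is crossed between loops of equal sign, so a
    word that is not lengthened alternates signs. *)
Lemma theta_expanding (p q r : seq letter) :
  p <> [::] -> q <> [::] -> r <> [::] ->
  sorted nocancel (p ++ r) -> sorted nocancel (r ++ p) ->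
  sorted nocancel (q ++ r) -> sorted nocancel (r ++ q) ->
  sorted nocancel (p ++ swinv q) -> sorted nocancel (swinv p ++ q) ->
  expanding (wd (p ++ r)) (wd (q ++ r)).
Proof.
move=> p0 q0 r0 Hpr Hrp Hqr Hrq HpQ HPq.
pose mid l := let z := if l.1 then q else p in if l.2 then swinv z else z.
pose junc l m := if l.2 == m.2 then if l.2 then swinv r else r else [::].
pose h l := if l.2 then wd (swinv r) else 1.
apply: (@immersion_expanding _ _ mid junc h).
- by case=> [[] []]; rewrite /mid /=; try exact: swinv_neq0.
- have := (sorted_swinv_cat Hpr, sorted_swinv_cat Hrp).
  have := (sorted_swinv_cat Hqr, sorted_swinv_cat Hrq).
  have := (sorted_swinv_cat HpQ, sorted_swinv_cat HPq).
  rewrite !swinvK => -[HqP HQp] [HRQ HQR] [HRP HPR].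
  by case=> [[] []] [[] []] //= _; rewrite /mid /junc //=; apply: sorted_glue => //; apply: swinv_neq0.
- by case=> [[] []]; rewrite /ev /mid /h /= ?wd_cat ?wd_swinv ?invgM ?invg1 ?invgK ?mulg1 ?mul1g.
- by case=> [[] []] [[] []] //= _; rewrite /junc /h /= ?wd0 ?wd_swinv ?invgK ?invg1 ?mulg1 ?mul1g ?mulgV ?mulVg.
move=> w _ _ Hw; apply/orP; right; apply: sub_cycle Hw => l m.
rewrite /junc -size_eq0 size_cat; case: (l.2 =P m.2) => // _.
have r1 : (size r == 0)%N = false by case: (r) r0.
by case: ifP => _; rewrite addn_eq0 ?size_swinv r1 andbF.
Qed.

(** Barbell with bar [k]. A change of generator crosses the bar, so a word that is not lengthened
    uses one generator. *)
Lemma barbell_expanding (p q k : seq letter) :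
  p <> [::] -> q <> [::] -> k <> [::] ->
  sorted nocancel (p ++ p) -> sorted nocancel (q ++ q) ->
  sorted nocancel (k ++ q) -> sorted nocancel (q ++ swinv k) ->
  sorted nocancel (p ++ k) -> sorted nocancel (swinv k ++ p) ->
  expanding (wd p) (wd (k ++ q ++ swinv k)).
Proof.
move=> p0 q0 k0 Hpp Hqq Hkq HqK Hpk HKp.
pose mid l := let z := if l.1 then q else p in if l.2 then swinv z else z.
pose junc l m := if l.1 == m.1 then [::] else if m.1 then k else swinv k.
pose h l := if l.1 then wd k else 1.
apply: (@immersion_expanding _ _ mid junc h).
- by case=> [[] []]; rewrite /mid /=; try exact: swinv_neq0.
- have := (sorted_swinv_cat Hpp, sorted_swinv_cat Hqq).
  have := (sorted_swinv_cat Hkq, sorted_swinv_cat HqK).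
  have := (sorted_swinv_cat Hpk, sorted_swinv_cat HKp).
  rewrite !swinvK => -[HKP HPk] [HQK HkQ] [HPP HQQ].
  by case=> [[] []] [[] []] //= _; rewrite /mid /junc //=; apply: sorted_glue => //; apply: swinv_neq0.
- by case=> [[] []]; rewrite /ev /mid /h /= ?wd_cat ?wd_swinv ?invgM ?invg1 ?invgK ?mulg1 ?mul1g ?mulgA.
- by case=> [[] []] [[] []] //= _; rewrite /junc /h /= ?wd0 ?wd_swinv ?invgK ?invg1 ?mulg1 ?mul1g ?mulgV ?mulVg.
move=> w _ _ Hw; apply/orP; left; apply: sub_cycle Hw => l m.
rewrite /junc -size_eq0 size_cat; case: (l.1 =P m.1) => // _.
have k1 : (size k == 0)%N = false by case: (k) k0.
by case: ifP => _; rewrite addn_eq0 ?size_swinv k1 andbF.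
Qed.

Lemma cycle_all (T : Type) (P : pred T) (s : seq T) : cycle (fun a _ => P a) s -> all P s.
Proof.
case: s => // a s /=; suff H b (t : seq T) : path (fun a _ => P a) b t = all P (belast b t).
  by rewrite H belast_rcons.
by elim: t b => //= c t IH b; rewrite IH.
Qed.

(** The loops meet in one vertex and junctions are empty, so a word that is not lengthened avoids a
    loop with more than one letter. *)
Lemma rose_expanding (p q : seq letter) :
  p <> [::] -> q <> [::] -> (1 < size p) || (1 < size q) ->
  sorted nocancel (p ++ p) -> sorted nocancel (q ++ q) ->
  sorted nocancel (p ++ q) -> sorted nocancel (p ++ swinv q) ->
  sorted nocancel (swinv p ++ q) -> sorted nocancel (swinv p ++ swinv q) ->
  expanding (wd p) (wd q).
Proof.
move=> p0 q0 Hsz Hpp Hqq Hpq HpQ HPq HPQ.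
pose mid l := let z := if l.1 then q else p in if l.2 then swinv z else z.
apply: (@immersion_expanding _ _ mid (fun _ _ => [::]) (fun=> 1)).
- by case=> [[] []]; rewrite /mid /=; try exact: swinv_neq0.
- have := (sorted_swinv_cat Hpp, sorted_swinv_cat Hqq).
  have := (sorted_swinv_cat Hpq, sorted_swinv_cat HpQ).
  have := (sorted_swinv_cat HPq, sorted_swinv_cat HPQ).
  rewrite !swinvK => -[HQp Hqp] [HQP HqP] [HPP HQQ].
  by case=> [[] []] [[] []].
- by case=> [[] []]; rewrite /ev /mid /= ?wd_swinv ?invg1 ?mulg1 ?mul1g.
- by move=> *; rewrite wd0 invg1 mulg1.
move=> w _ _ Hw; apply/orP; left.
suff [g Hg] : exists g : bool, all (fun l => l.1 == g) w.
  by apply: sub_in_cycle Hg (Hw) => l m /eqP-> /eqP->.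
have {Hw} : all (fun l => size (mid l) <= 1) w.
  apply: cycle_all; apply: sub_cycle Hw => l m; by rewrite cats0 -size_eq0 size_behead; case: (size _) => [|[]].
move=> Hw; case/orP: Hsz => Hsz; [exists true | exists false];
by apply: sub_all Hw => -[[] []] //=; rewrite /mid /= ?size_swinv leqNgt Hsz.
Qed.

(** * Nielsen reduction *)

Lemma common_prefix s t : exists r p q : seq letter, [/\ s = r ++ p, t = r ++ q &
  sorted nocancel s -> sorted nocancel t -> sorted nocancel (swinv p ++ q)].
Proof.
elim: s t => [|l s IH] t; first by exists [::], [::], t.
case: t => [|m t].
  by exists [::], (l :: s), [::]; split=> // Hs _; rewrite cats0 sorted_swinv.
have [->|Nlm] := eqVneq l m.
  have [r [p [q [-> -> H]]]] := IH t; exists (m :: r), p, q; split=> // Hs Ht.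
  by apply: H; [apply: path_sorted Hs | apply: path_sorted Ht].
exists [::], (l :: s), (m :: t); split=> // Hs Ht.
rewrite swinv_cons; apply: sorted_glue1 => //.
  by rewrite /nocancel linvK eq_sym.
by rewrite -swinv_cons sorted_swinv.
Qed.

Lemma common_suffix s t : exists r p q : seq letter, [/\ s = p ++ r, t = q ++ r &
  sorted nocancel s -> sorted nocancel t -> sorted nocancel (p ++ swinv q)].
Proof.
have [r [p [q [Es Et H]]]] := common_prefix (swinv s) (swinv t).
exists (swinv r), (swinv p), (swinv q); split.
- by rewrite -swinv_cat -Es swinvK.
- by rewrite -swinv_cat -Et swinvK.
by rewrite swinvK -(sorted_swinv s) -(sorted_swinv t).
Qed.

Definition shortest a b :=
  forall c d, nielsen a b c d -> len a + len b <= len c + len d.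

Lemma shortest_step a b c d : shortest a b -> nielsen a b c d ->
  len c + len d <= len a + len b -> shortest c d.
Proof.
move=> Hab Hcd Hle e f Hef; apply: leq_trans Hle _.
exact: Hab (Ntrans Hcd Hef).
Qed.

Lemma cycred_rot s t : cycred (s ++ t) -> cycred (t ++ s).
Proof. by rewrite /cycred -rot_size_cat rot_cycle. Qed.

Lemma cycred_double s : cycred s -> sorted nocancel (s ++ s).
Proof.
move=> Hs; have := cycle_sorted (cycle_flatten_nseq 2 Hs).
by rewrite /= cats0.
Qed.

Lemma cycred_swinv s : cycred s -> cycred (swinv s).
Proof.
rewrite /cycred /swinv rev_cycle cycle_map.
by rewrite (eq_cycle (e' := nocancel)) // => l m; apply: nocancelV.
Qed.

Lemma len_cycred s : cycred s -> len (wd s) = size s.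
Proof. by move/cycle_sorted/len_wd_reduced. Qed.

(** [k] is the common suffix, nonempty by the cancellation, and [r] the common prefix of what
    remains. Conjugation by [r] gives a theta graph with edges [p2], [q2], [k ++ r]. *)
Lemma overlap_theta (p q : seq letter) : p <> [::] -> q <> [::] ->
  cycred p -> cycred q -> shortest (wd p) (wd q) ->
  ~~ sorted nocancel (p ++ swinv q) ->
  exists c d, nielsen (wd p) (wd q) c d /\ expanding c d.
Proof.
move=> p0 q0 Hp Hq Hpq Npq.
have [k [p1 [q1 [Ep Eq Hk]]]] := common_suffix p q.
have Hs : sorted nocancel (p1 ++ swinv q1).
  by apply: Hk; apply: cycle_sorted.
have k0 : k <> [::].
  by move=> k0; move: Npq; rewrite Ep Eq k0 !cats0 Hs.
have [r [p2 [q2 [Ep1 Eq1 Hr]]]] := common_prefix p1 q1.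
have {Hr} Hr : sorted nocancel (swinv p2 ++ q2).
  apply: Hr.
    by move: (cycle_sorted Hp); rewrite Ep; apply: sorted_catl.
  by move: (cycle_sorted Hq); rewrite Eq; apply: sorted_catl.
rewrite {}Ep1 {}Eq1 in Ep Eq Hs.
have Np : nielsen (wd p) (wd q) (wd (p2 ++ k ++ r)) (wd (q2 ++ k ++ r)).
  have -> : wd (p2 ++ k ++ r) = wd p ^ wd r.
    by rewrite Ep !wd_cat conjgE !mulgA mulVg mul1g.
  have -> : wd (q2 ++ k ++ r) = wd q ^ wd r.
    by rewrite Eq !wd_cat conjgE !mulgA mulVg mul1g.
  exact/Nconj/Nrefl.
have Cp : cycred (p2 ++ k ++ r) by rewrite catA; apply: cycred_rot; rewrite catA -Ep.
have Cq : cycred (q2 ++ k ++ r) by rewrite catA; apply: cycred_rot; rewrite catA -Eq.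
exists (wd (p2 ++ k ++ r)), (wd (q2 ++ k ++ r)); split=> //.
have kr0 : k ++ r <> [::] by case: (k) k0.
have Hsh : shortest (wd (p2 ++ k ++ r)) (wd (q2 ++ k ++ r)).
  apply: shortest_step Hpq Np _; rewrite !len_cycred // Ep Eq !size_cat; lia.
have krp : 0 < size (k ++ r) by case: (k ++ r) kr0.
apply: theta_expanding => //.
(* With [p2] empty, dividing the second entry by the first leaves [q2], which contradicts
   minimality. *)
- move=> p20; have := Hsh (wd (p2 ++ k ++ r)) (wd q2).
  rewrite (len_cycred Cp) (len_cycred Cq) p20 /= => H.
  suff /H : nielsen (wd (k ++ r)) (wd (q2 ++ k ++ r)) (wd (k ++ r)) (wd q2).
    by have := len_wd q2; move: krp; rewrite !size_cat; lia.
  apply: Nswap; have -> : wd q2 = wd (q2 ++ k ++ r) / wd (k ++ r) by rewrite [in RHS]wd_cat mulgK.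
  exact/NmulV/Nswap/Nrefl.
- move=> q20; have := Hsh (wd p2) (wd (q2 ++ k ++ r)).
  rewrite (len_cycred Cp) (len_cycred Cq) q20 /= => H.
  suff /H : nielsen (wd (p2 ++ k ++ r)) (wd (k ++ r)) (wd p2) (wd (k ++ r)).
    by have := len_wd p2; move: krp; rewrite !size_cat; lia.
  have -> : wd p2 = wd (p2 ++ k ++ r) / wd (k ++ r) by rewrite [in RHS]wd_cat mulgK.
  exact/NmulV/Nrefl.
- exact: cycle_sorted Cp.
- by apply: cycle_sorted; apply: cycred_rot.
- exact: cycle_sorted Cq.
- by apply: cycle_sorted; apply: cycred_rot.
- by move: Hs; rewrite swinv_cat -!catA => /sorted_catr; rewrite catA => /sorted_catl.
Qed.

Lemma shortest_exists a b : exists c d, nielsen a b c d /\ shortest c d.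
Proof.
have [n] := ubnP (len a + len b); elim: n a b => // n IH a b Hn.
have [Hs|Hs] := classic (shortest a b); first by exists a, b; split=> //; apply: Nrefl.
have [c [d [Hcd Hlt]]] : exists c d, nielsen a b c d /\ len c + len d < len a + len b.
  apply: NNPP => Hex; apply: Hs => c d Hcd; rewrite leqNgt; apply/negP => Hlt.
  by apply: Hex; exists c, d.
have [|e [f [Hef Hs']]] := IH c d; first by apply: leq_trans Hlt _.
by exists e, f; split=> //; apply: Ntrans Hcd Hef.
Qed.

Definition normal_pair c d :=
  [\/ c = 1, exists e1 e2, c = gl (false, e1) /\ d = gl (true, e2) | expanding c d].

Lemma shortestVl a b : shortest a b -> shortest a^-1 b.
Proof. by move=> H; apply: shortest_step H _ _; [apply/Ninv/Nrefl | rewrite lenV]. Qed.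

Lemma shortestVr a b : shortest a b -> shortest a b^-1.
Proof. by move=> H; apply: shortest_step H _ _; [apply/Ninvr/Nrefl | rewrite lenV]. Qed.

(** A cancellation in one of the four products of [p] and [q] up to inversion gives a theta graph.
    Otherwise the pair is a rose, or two letters, necessarily on distinct generators. *)
Lemma shortest_cycred_normal (p q : seq letter) : p <> [::] -> q <> [::] ->
  cycred p -> cycred q -> shortest (wd p) (wd q) ->
  exists c d, nielsen (wd p) (wd q) c d /\ normal_pair c d.
Proof.
move=> p0 q0 Hp Hq Hs.
have [HP HQ] := (cycred_swinv Hp, cycred_swinv Hq).
have [HpQ|Npq] := boolP (sorted nocancel (p ++ swinv q)); last first.
  have [c [d [Hcd He]]] := overlap_theta p0 q0 Hp Hq Hs Npq.
  by exists c, d; split=> //; constructor 3.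
have [Hpq|Npq] := boolP (sorted nocancel (p ++ q)); last first.
  have [||c [d [Hcd He]]] := overlap_theta p0 (swinv_neq0 q0) Hp HQ.
  - by rewrite wd_swinv; apply: shortestVr.
  - by rewrite swinvK.
  exists c, d; split; last by constructor 3.
  by apply: Ntrans Hcd; rewrite wd_swinv; apply/Ninvr/Nrefl.
have [HPQ|Npq] := boolP (sorted nocancel (swinv p ++ swinv q)); last first.
  have [||c [d [Hcd He]]] := overlap_theta (swinv_neq0 p0) q0 HP Hq.
  - by rewrite wd_swinv; apply: shortestVl.
  - by [].
  exists c, d; split; last by constructor 3.
  by apply: Ntrans Hcd; rewrite wd_swinv; apply/Ninv/Nrefl.
have [HPq|Npq] := boolP (sorted nocancel (swinv p ++ q)); last first.
  have [||c [d [Hcd He]]] := overlap_theta (swinv_neq0 p0) (swinv_neq0 q0) HP HQ.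
  - by rewrite !wd_swinv; apply/shortestVl/shortestVr.
  - by rewrite swinvK.
  exists c, d; split; last by constructor 3.
  by apply: Ntrans Hcd; rewrite !wd_swinv; apply/Ninv/Ninvr/Nrefl.
have [Hsz|] := boolP ((1 < size p) || (1 < size q)).
  exists (wd p), (wd q); split; first exact: Nrefl.
  by constructor 3; apply: rose_expanding => //; apply: cycred_double.
case: p p0 {Hp HP Hs} Hpq HpQ HPq HPQ => [|l [|? ?]] // _.
case: q q0 {Hq HQ} => [|m [|? ?]] // _.
rewrite /swinv /rev /= /nocancel => H1 H2 H3 H4 _.
case: l m H1 H2 H3 H4 => [[] e1] [[] e2] => H1 H2 H3 H4.
- by case: e1 e2 H1 H2 H3 H4 => [] [].
- exists (gl (false, e2)), (gl (true, e1)); split; first exact/Nswap/Nrefl.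
  by constructor 2; exists e2, e1.
- exists (gl (false, e1)), (gl (true, e2)); split; first exact/Nrefl.
  by constructor 2; exists e1, e2.
- by case: e1 e2 H1 H2 H3 H4 => [] [].
Qed.

Lemma val_neq_nil x : (val x != [::]) = (x != 1).
Proof. by []. Qed.

(** Make the first entry of a shortest pair cyclically reduced. If the second is not, its
    conjugating prefix is the bar of a barbell. *)
Lemma nielsen_normal a b : exists c d, nielsen a b c d /\ normal_pair c d.
Proof.
have [a1 [b1 [Hab Hs]]] := shortest_exists a b.
suff [c [d [Hcd Hn]]] : exists c d, nielsen a1 b1 c d /\ normal_pair c d.
  by exists c, d; split=> //; apply: Ntrans Hab Hcd.
move: a1 b1 Hs {a b Hab} => a b Hs.
have [->|a1] := eqVneq a 1; first by exists 1, b; split; [apply: Nrefl | constructor 1].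
have [E|b1] := eqVneq b 1.
  by exists 1, a; split; [rewrite -E; apply/Nswap/Nrefl | constructor 1].
have [g [p [Ea Hp p0]]] := reduced_cycred (val_reduced a).
have {}p0 : p <> [::] by apply/eqP/p0; rewrite val_neq_nil.
have Ep : a ^ wd g = wd p by rewrite -(wd_val a) Ea wd_conj conjgKV.
have Np : nielsen a b (wd p) (b ^ wd g) by rewrite -Ep; apply/Nconj/Nrefl.
(* Conjugation removes [2 * size g] letters from [a] and adds at most as many to [b]. *)
have {}Hs : shortest (wd p) (b ^ wd g).
  apply: shortest_step Hs Np _; rewrite len_cycred // {2}/len Ea !size_cat size_swinv.
  rewrite [_ + len b]addnC addnC; apply: leq_trans (leq_add (lenJ _ _) (leqnn _)) _.
  by have := len_wd g; lia.
have {}b1 : b ^ wd g != 1 by rewrite conjg_eq1.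
suff [c [d [Hcd Hn]]] : exists c d, nielsen (wd p) (b ^ wd g) c d /\ normal_pair c d.
  by exists c, d; split=> //; apply: Ntrans Np Hcd.
move: (b ^ wd g) b1 Hs => {a a1 g Ea Ep Np} {}b b1 Hs.
have [k [q [Eb Hq q0]]] := reduced_cycred (val_reduced b).
have {}q0 : q <> [::] by apply/eqP/q0; rewrite val_neq_nil.
have [k0|/eqP k0] := eqVneq k [::].
  have E : b = wd q by rewrite -(wd_val b) Eb k0 cats0.
  by rewrite E in Hs *; apply: shortest_cycred_normal.
exists (wd p), b; split; first exact: Nrefl.
constructor 3; rewrite -(wd_val b) Eb.
have Hb := val_reduced b; rewrite Eb in Hb.
have Hkq : sorted nocancel (k ++ q) by move: Hb; rewrite catA => /sorted_catl.
have HqK : sorted nocancel (q ++ swinv k) by move: Hb => /sorted_catr.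
case: k k0 Eb Hb Hkq HqK => // l k _ Eb Hb Hkq HqK.
(* Conjugation by the first letter of the bar shortens [b] by two, so it has to lengthen [p] by two:
   nothing cancels between [p] and the bar. *)
have Hl : sorted nocancel (linv l :: rcons p l).
  apply: len_wd_eq; apply/eqP; rewrite eqn_leq len_wd /= size_rcons.
  have := Hs (wd p ^ gl l) (b ^ gl l) (Nconj _ (Nrefl _ _)).
  have -> : wd (linv l :: rcons p l) = wd p ^ gl l.
    by rewrite wd_cons wd_rcons gl_linv conjgE.
  have -> : b ^ gl l = wd (k ++ q ++ swinv k).
    have -> : b = gl l * wd (k ++ q ++ swinv k) / gl l.
      by rewrite -(wd_val b) Eb swinv_cons -wd_cons -gl_linv -wd_rcons /= !rcons_cat.
    by rewrite conjgE mulgVK mulKg.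
  rewrite len_cycred // {1}/len Eb swinv_cons /= !size_cat size_rcons size_swinv.
  by have := len_wd (k ++ q ++ swinv k); rewrite !size_cat size_swinv; lia.
apply: barbell_expanding => //; try exact: cycred_double.
- rewrite -cat1s; apply: sorted_glue => //; first by rewrite cats1; apply: path_sorted Hl.
  by move: Hb => /sorted_catl.
- rewrite swinv_cons -cats1 -catA; apply: sorted_glue => //.
    by rewrite cats1 -swinv_cons sorted_swinv; move: Hb => /sorted_catl.
  by move: Hl; rewrite -cats1 => /(@sorted_catl _ _ (linv l :: p)).
Qed.

(** * Abelianization and generation of the automorphism group *)

(** [wt], [ab] and [ex] give exponent sums, the coordinates of the abelianization. *)
Definition wt (i : bool) l : int :=
  (if l.1 == i then if l.2 then -1 else 1 else 0)%R.

Definition ab (i : bool) s : int := foldr (fun l k => wt i l + k)%R 0%R s.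

Definition ex (i : bool) x : int := ab i (val x).

Lemma wt_linv i l : wt i (linv l) = (- wt i l)%R.
Proof. by case: l i => [[] []] []. Qed.

Lemma ab_cat i s t : ab i (s ++ t) = (ab i s + ab i t)%R.
Proof. by elim: s => [|l s IH] /=; rewrite ?GRing.add0r // IH GRing.addrA. Qed.

Lemma ab_red i s : ab i (red s) = ab i s.
Proof.
elim: s => //= l s <-; case: (red s) => //= m t; case: eqP => //= ->.
by rewrite wt_linv GRing.addNKr.
Qed.

Lemma ex_wd i s : ex i (wd s) = ab i s.
Proof. exact: ab_red. Qed.

Lemma exM i x y : ex i (x * y) = (ex i x + ex i y)%R.
Proof. by rewrite /ex -ab_cat; apply: ab_red. Qed.

Lemma exV i x : ex i x^-1 = (- ex i x)%R.
Proof.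
by apply/eqP; rewrite -GRing.subr_eq0 GRing.opprK -exM mulVg.
Qed.

Lemma exJ i x g : ex i (x ^ g) = ex i x.
Proof. by rewrite conjgE !exM exV GRing.addrCA GRing.addNr GRing.addr0. Qed.

Lemma exX i x n : ex i (x ^+ n) = (ex i x *+ n)%R.
Proof. by elim: n => [|n IH]; rewrite ?expg0 // expgS exM IH GRing.mulrS. Qed.

Lemma ex_endo f i x : is_endo f ->
  ex i (f x) = (ex false x * ex i (f gx) + ex true x * ex i (f gy))%R.
Proof.
move=> Ef; rewrite (endo_hom Ef); move: (f gx) (f gy) => a b.
rewrite -{1 2 3}(wd_val x) hom_wd !ex_wd; elim: (val x) => [|l s IH] /=.
  by rewrite !GRing.mul0r.
rewrite exM IH !GRing.mulrDl GRing.addrACA; congr (_ + _)%R.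
case: l => [[] []]; rewrite /ev /wt /= ?exV.
all: by rewrite ?GRing.mulN1r ?GRing.mul1r ?GRing.mul0r ?GRing.add0r ?GRing.addr0.
Qed.

(** The inverse acts linearly on exponent sums and takes those of [f gx] to (1, 0). *)
Lemma aut_ex_neq0 f : is_aut f -> ~ (ex false (f gx) = 0 /\ ex true (f gx) = 0)%R.
Proof.
move=> Af [E1 E2]; have [h [Eh _] [fK _]] := aut_inv Af.
by have := ex_endo false (f gx) Eh; rewrite fK E1 E2 !GRing.mul0r.
Qed.

Lemma aut_letters l m : l.1 != m.1 -> is_aut (hom (gl l) (gl m)).
Proof.
case: l m => [[] e1] [[] e2] //= _.
- apply: (hom_aut (c := gl (true, e2)) (d := gl (false, e1)));
  by rewrite !hom_gl; case: e1 e2 => [] [] //; apply: val_inj.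
- apply: (hom_aut (c := gl (false, e1)) (d := gl (true, e2)));
  by rewrite !hom_gl; case: e1 e2 => [] [] //; apply: val_inj.
Qed.

Lemma letter_aut l : exists2 f, is_aut f & f gx = gl l.
Proof.
exists (hom (gl l) (gl (~~ l.1, false))); last by rewrite hom_gx.
by apply: aut_letters; case: l.1.
Qed.

Lemma letters_aut l m : l.1 != m.1 -> exists2 f, is_aut f & f gx = gl l * gl m.
Proof.
move=> Hlm; exists (hom (gl l) (gl m) \o hom (gx * gy) gy).
  by apply: aut_comp aut_mul; apply: aut_letters.
by rewrite /= hom_gx (endoM (hom_endo _ _)) hom_gx hom_gy.
Qed.

(** With one generator, absence of cancellation makes all letters equal. With alternating signs, it
    makes the generators alternate too, so the word is a power of a product of two letters on
    distinct generators, which is primitive. *)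
Lemma powerlike_pow (w : seq letter) : w <> [::] -> cycred w -> powerlike w ->
  exists n f, [/\ is_aut f & wd w = f gx ^+ n.+1].
Proof.
case: w => // l s _; rewrite /cycred => Hc /orP[] Hp.
  have [f Af Ef] := letter_aut l; exists (size s), f; split=> //; rewrite {}Ef.
  have H m t : path nocancel m t -> path (fun l m => l.1 == m.1) m t ->
      wd t = gl m ^+ size t.
    elim: t m => [|k t IH] m /=; first by rewrite wd0.
    move=> /andP[Hn Hc1] /andP[He Hp1]; rewrite wd_cons (IH _ Hc1 Hp1) expgS.
    suff -> : k = m by [].
    by move: Hn He; case: (k) (m) => [[] []] [[] []].
  move: Hc Hp => /= Hc Hp; rewrite wd_cons expgS; congr (_ * _).
  apply: H.
    by move: Hc; rewrite -cats1; apply: sorted_cat_path.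
  by move: Hp; rewrite -cats1; apply: sorted_cat_path.
pose sw l : letter := (~~ l.1, ~~ l.2).
have {Hc Hp} : fcycle sw (l :: s).
  have : cycle [rel l m | nocancel l m && (l.2 != m.2)] (l :: s).
    by rewrite cycle_relI; apply/andP.
  by apply: sub_cycle => -[[] []] [[] []].
have [f Af Ef] : exists2 f, is_aut f & f gx = gl l * gl (sw l).
  by apply: letters_aut; case: l => [[] []].
move=> Hp; suff [n En] : exists n, wd (l :: s) = (gl l * gl (sw l)) ^+ n.+1.
  by exists n, f; rewrite Ef.
have [n] := ubnP (size s); elim: n s Hp => // n IH [|m s].
  by rewrite /= andbT; case: (l) => [[] []].
case: s => [|k s]; move=> /= /andP[/eqP <-].
  by exists 0; rewrite wd_cons.
move=> /andP[/eqP <-]; have -> : sw (sw l) = l by case: (l) => [g e]; rewrite /sw /= !negbK.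
move=> Hp Hn; have [||i Ei] := IH s; [exact: Hp | by lia |].
by exists i.+1; rewrite 2!wd_cons Ei [RHS]expgS mulgA.
Qed.

Lemma powerlike_ab (w : seq letter) : w <> [::] -> cycred w -> powerlike w ->
  ~ (ab false w = 0 /\ ab true w = 0)%R.
Proof.
move=> w0 Hw /(powerlike_pow w0 Hw)[n [f [Af Ew]]].
rewrite -!ex_wd Ew !exX => -[/eqP E1 /eqP E2].
apply: (aut_ex_neq0 Af); move: E1 E2.
by rewrite !Num.Theory.mulrn_eq0 /= => /eqP-> /eqP->.
Qed.

Definition comm_word : seq letter :=
  [:: (false, false); (true, false); (false, true); (true, true)].

Lemma short_ab0 (w : seq letter) : cycred w -> (size w < 4)%N ->
  ab false w = 0%R -> ab true w = 0%R -> w = [::].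
Proof.
case: w => [|[[] []] [|[[] []] [|[[] []] [|? ?]]]] //.
Qed.

(* A surjective expanding pair is impossible: a cyclic word mapped to the commutator would
   be shorter than 4 or a power of a primitive element, and have zero abelianization. *)
Lemma aut_not_expanding a b : is_aut (hom a b) -> ~ expanding a b.
Proof.
move=> Af Hexp; have [h Ah [fK hK]] := aut_inv Af.
have [w [g [Hw Ew]]] := cycred_rep (h (wd comm_word)).
have ab0 i : ab i w = 0%R.
  rewrite -ex_wd -(exJ i _ g) -Ew (ex_endo _ _ (proj1 Ah)) !ex_wd.
  by rewrite !GRing.mul0r.
have w0 : w <> [::].
  move=> w0; move: Ew; rewrite w0 wd0 conj1g => /(congr1 (hom a b)).
  by rewrite hK (endo1 (hom_endo _ _)).
have [z [k [Hz Ez Hle Heq]]] := Hexp w w0 Hw.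
have {Ez} Ez : wd z = wd comm_word ^ ((hom a b g)^-1 * k).
  by rewrite conjgM -[wd comm_word]hK Ew (endoJ (hom_endo _ _)) conjgK.
have Sz : size z = 4 by rewrite (cycred_conj Hz _ Ez).
have [Hlt|Hge] := ltnP (size w) 4.
  exact: w0 (short_ab0 Hw Hlt (ab0 _) (ab0 _)).
apply: (powerlike_ab w0 Hw _); last by split; apply: ab0.
by apply: Heq; apply/eqP; rewrite eqn_leq Hle Sz.
Qed.

(** Nielsen's generation theorem. In the normal form of the image of the basis, a trivial entry
    contradicts injectivity and an expanding pair is excluded by the commutator, which leaves a pair
    of letters. *)
Lemma aut_nielsen f : is_aut f -> nielsen gx gy (f gx) (f gy).
Proof.
move=> Af; have [c [d [Hcd Hn]]] := nielsen_normal (f gx) (f gy).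
have Acd : is_aut (hom c d).
  have [beta Ab [g E]] := nielsen_aut Hcd.
  apply: (aut_ext (f := conjg^~ g \o (f \o beta))).
    by move=> x /=; rewrite E -endo_hom //; case: Af.
  by apply: aut_comp (aut_conj _) (aut_comp Af Ab).
apply: Ntrans (Nsym Hcd); case: Hn => [c1|[e1 [e2 [-> ->]]]|/(aut_not_expanding Acd)//].
  have [_ /bij_inj Hinj] := Acd.
  have : hom c d gx = hom c d 1 by rewrite hom_gx c1 (endo1 (hom_endo _ _)).
  by move/Hinj.
have H2 : nielsen gx gy gx (gl (true, e2)).
  case: e2 => //; last exact: Nrefl.
  have -> : gl (true, true) = gy^-1 by rewrite -gl_linv.
  exact/Ninvr/Nrefl.
case: e1 => //.
have -> : gl (false, true) = gx^-1 by rewrite -gl_linv.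
exact/Ninv.
Qed.

(** * Primitive elements *)

(** A positive word in the basis of generators with signs [e]; nothing can cancel in it. *)
Definition coherent (e : bool -> bool) s := all (fun l => l.2 == e l.1) s.

Lemma coherent_path e l s : coherent e (l :: s) -> path nocancel l s.
Proof.
elim: s l => //= m s IH l /and3P[/eqP El /eqP Em Hs].
rewrite IH /= ?Em ?eqxx // andbT /nocancel; apply/eqP => E.
by move: Em; rewrite E /= El; case: (e _).
Qed.

Lemma coherent_sorted e s : coherent e s -> sorted nocancel s.
Proof. by case: s => // l s; apply: coherent_path. Qed.

Lemma coherent_cycred e s : coherent e s -> cycred s.
Proof.
case: s => // l s Hs; apply: (@coherent_path e).
by move: Hs; rewrite /coherent /= all_rcons andbA andbb.
Qed.

Lemma coherent_swinv e s : coherent e s -> coherent (negb \o e) (swinv s).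
Proof.
rewrite /coherent all_rev all_map; apply: sub_all => l /=.
by move/eqP->.
Qed.

Lemma coherent_size e s : coherent e s ->
  size s = (`|ab false s| + `|ab true s|)%N.
Proof.
move=> Hs; have H i : ab i s = (if e i then - (count (fun l => l.1 == i) s)%:Z
    else (count (fun l => l.1 == i) s)%:Z)%R.
  elim: s Hs => [|l s IH] /=; first by case: (e i).
  move=> /andP[/eqP El /IH->]; rewrite /wt El.
  have [->|_] := eqVneq l.1 i; first by case: (e i); rewrite PoszD ?GRing.opprD.
  by rewrite GRing.add0r add0n.
have -> : size s = (count (fun l => l.1 == false) s + count (fun l => l.1 == true) s)%N.
  by rewrite -(count_predC (fun l => l.1 == false)); congr addn; apply: eq_count => -[[] []].
by rewrite !H; case: (e false); case: (e true); rewrite ?abszN.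
Qed.

Inductive positive (e : bool -> bool) : F2 -> F2 -> Prop :=
| pos_gen : positive e (gl (false, e false)) (gl (true, e true))
| pos_mul a b : positive e a b -> positive e (a * b) b
| pos_swap a b : positive e a b -> positive e b a.

Lemma positive_coherent e a b :
  positive e a b -> coherent e (val a) /\ coherent e (val b).
Proof.
elim=> {a b} [|a b _ [Ha Hb]|a b _ [Ha Hb]] //.
  by rewrite /coherent /= !eqxx.
split=> //; have Hab : coherent e (val a ++ val b) by rewrite /coherent all_cat; apply/andP.
suff -> : val (a * b) = val a ++ val b by [].
by rewrite -(wd_val a) -(wd_val b) -wd_cat !wd_val val_wd_reduced // (coherent_sorted Hab).
Qed.

Definition sg (i : bool) x := if i then x^-1 else x.

Definition signed c d := exists e i j g a b,
  [/\ positive e a b, c = sg i a ^ g & d = sg j b ^ g].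

Lemma sgV i x : (sg i x)^-1 = sg (~~ i) x.
Proof. by case: i; rewrite /sg ?invgK. Qed.

Lemma signed_pos e a b : positive e a b -> signed a b.
Proof. by move=> H; exists e, false, false, 1, a, b; rewrite !conjg1. Qed.

Lemma signed_swap c d : signed c d -> signed d c.
Proof.
move=> [e [i [j [g [a [b [H -> ->]]]]]]]; exists e, j, i, g, b, a.
by split=> //; apply: pos_swap.
Qed.

Lemma signedV c d : signed c d -> signed c^-1 d.
Proof.
move=> [e [i [j [g [a [b [H -> ->]]]]]]]; exists e, (~~ i), j, g, a, b.
by rewrite -conjVg sgV.
Qed.

Lemma signedVr c d : signed c d -> signed c d^-1.
Proof. by move=> /signed_swap/signedV/signed_swap. Qed.

Lemma signedJ c d g : signed c d -> signed (c ^ g) (d ^ g).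
Proof.
move=> [e [i [j [h [a [b [H -> ->]]]]]]]; exists e, i, j, (h * g), a, b.
by rewrite !conjgM.
Qed.

(** Division undoes the last multiplication or, for a pair of letters, is multiplication after
    flipping the sign of the second generator. The two conclusions go together because [pos_swap]
    exchanges them up to inversion. *)
Lemma signed_div e a b : positive e a b -> signed (a / b) b /\ signed (a / b) a.
Proof.
elim=> {a b} [|a b Hab _|a b Hab [IH1 IH2]].
- pose e' i := if i then ~~ e i else e i.
  have Ey : gl (true, e' true) = (gl (true, e true))^-1 by rewrite -gl_linv.
  have H := pos_gen e'; rewrite Ey in H.
  move: (gl (true, _)) H => y; rewrite /e'; move: (gl _) => x H; split.
    by rewrite -[X in signed _ X]invgK; apply/signedVr/signed_pos/pos_mul/H.
  have -> : x / y = (y^-1 * x) ^ x^-1 by rewrite conjgE invgK mulgK.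
  have Ex : x = x ^ x^-1 by rewrite conjgE mulgV mulg1 invgK.
  rewrite {3}Ex.
  exact/signedJ/signed_pos/pos_mul/pos_swap/H.
- rewrite mulgK; split; first exact: signed_pos Hab.
  have -> : a * b = (b * a) ^ a^-1 by rewrite conjgE invgK mulgK.
  have Ea : a = a ^ a^-1 by rewrite conjgE mulgV mulg1 invgK.
  rewrite {1}Ea; exact/signedJ/signed_swap/signed_pos/pos_mul/pos_swap/Hab.
- by rewrite -invgF; split; apply: signedV.
Qed.

(** Equal signs give a product of positive words, up to inversion and conjugation; opposite signs
    give a quotient, as in [signed_div]. *)
Lemma signed_mul c d : signed c d -> signed (c * d) d.
Proof.
move=> [e [i [j [g [a [b [H -> ->]]]]]]]; rewrite -conjMg; apply: signedJ.
case: i j => [] []; rewrite /sg.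
- have -> : a^-1 * b^-1 = (a * b)^-1 ^ b^-1 by rewrite conjgE invgK invgM -mulgA mulVKg.
  have {2}-> : b^-1 = b^-1 ^ b^-1 by rewrite conjgE invgK mulVKg.
  exact/signedJ/signedV/signedVr/signed_pos/pos_mul/H.
- have -> : a^-1 * b = (a / b)^-1 ^ b by rewrite conjgE invgF -mulgA mulKg.
  have {3}-> : b = b ^ b by rewrite conjgE mulKg.
  by apply/signedJ/signedV; case: (signed_div H).
- by apply: signedVr; case: (signed_div H).
- exact: signed_pos (pos_mul H).
Qed.

Lemma nielsen_signed c d : nielsen gx gy c d -> signed c d.
Proof.
elim=> {c d} [|c d _|c d _|c d _|c d g _].
- exact: signed_pos (pos_gen (fun=> false)).
- exact: signed_swap.
- exact: signedV.
- exact: signed_mul.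
- exact: signedJ.
Qed.

(** Up to conjugation and inversion a primitive element is a coherent word, whose length is the l1
    norm of its exponent sums. *)
Lemma aut_coherent f : is_aut f -> exists c g,
  [/\ cycred c, f gx = wd c ^ g &
      size c = (`|ex false (f gx)| + `|ex true (f gx)|)%N].
Proof.
move=> /aut_nielsen/nielsen_signed[e [i [_ [g [a [_ [/positive_coherent[Ha _] -> _]]]]]]].
rewrite !exJ; case: i; rewrite /sg.
  have H := coherent_swinv Ha; have E : a^-1 = wd (swinv (val a)) by rewrite wd_swinv wd_val.
  exists (swinv (val a)), g; split; [exact: coherent_cycred H | by rewrite E|].
  by rewrite (coherent_size H) E !ex_wd.
exists (val a), g; split; [exact: coherent_cycred Ha | by rewrite wd_val|].
exact: coherent_size Ha.
Qed.

(** * Endomorphisms preserving powers of primitive elements *)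

Lemma gl_sg l : gl l = sg l.2 (if l.1 then gy else gx).
Proof. by case: l => [[] []]; rewrite /sg //= -gl_linv. Qed.

Lemma aut_compK f h : is_aut h -> is_aut (f \o h) -> is_aut f.
Proof.
move=> Ah Afh; have [k Ak [hK kK]] := aut_inv Ah.
by apply: aut_ext (aut_comp Afh Ak) => x /=; rewrite kK.
Qed.

Lemma aut_Kcomp f h : is_aut h -> is_aut (h \o f) -> is_aut f.
Proof.
move=> Ah Afh; have [k Ak [hK kK]] := aut_inv Ah.
by apply: aut_ext (aut_comp Ak Afh) => x /=; rewrite hK.
Qed.

Lemma aut_shear l n : l.1 = false -> is_aut (hom gx (gy * gl l ^+ n)).
Proof.
move=> Hl; have Hgl d : hom gx d (gl l) = gl l.
  by rewrite hom_gl; case: (l) Hl => [[] []] //= _; rewrite /ev -gl_linv.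
apply: (hom_aut (c := gx) (d := gy / gl l ^+ n)); rewrite ?hom_gx //;
rewrite ?(endoM (hom_endo _ _)) ?(endoV (hom_endo _ _)) (endoX (hom_endo _ _)) Hgl hom_gy.
  by rewrite mulgK.
by rewrite mulgVK.
Qed.

Section PrimitivePowers.
Variable n : nat.

(** The primitive elements are the [a gx]; this is preservation of the orbit when [u] is the power
    of exponent [n.+1] of a primitive element. *)
Definition preserves_powers f := forall a, is_aut a ->
  exists2 b, is_aut b & f (a gx) ^+ n.+1 = b gx ^+ n.+1.

Lemma preserves_powers_compr f h :
  is_aut h -> preserves_powers f -> preserves_powers (f \o h).
Proof. by move=> Ah Hf a Aa; apply: (Hf (h \o a)); apply: aut_comp. Qed.

Lemma preserves_powers_compl f h :
  is_aut h -> preserves_powers f -> preserves_powers (h \o f).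
Proof.
move=> Ah Hf a Aa; have [b Ab E] := Hf a Aa.
exists (h \o b); first exact: aut_comp.
by rewrite /= -(endoX (proj1 Ah)) E (endoX (proj1 Ah)).
Qed.

Lemma exX_inj i x y : x ^+ n.+1 = y ^+ n.+1 -> ex i x = ex i y.
Proof.
by move=> /(congr1 (ex i)); rewrite !exX; apply: Num.Theory.pmulrnI.
Qed.

(** Exponent sums and cyclic length are multiplied by [n.+1] on passing to the power, so [f (a gx)]
    shares them with the primitive [b gx]. *)
Lemma preserves_powers_coherent f a : preserves_powers f -> is_aut a ->
  exists b c g, [/\ is_aut b, forall i, ex i (f (a gx)) = ex i (b gx),
    cycred c, f (a gx) = wd c ^ g &
    size c = (`|ex false (f (a gx))| + `|ex true (f (a gx))|)%N].
Proof.
move=> Hf Aa; have [b Ab E] := Hf a Aa.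
have Eex i := exX_inj i E.
have [c [g [Hc Ec]]] := cycred_rep (f (a gx)).
exists b, c, g; split=> //; rewrite !Eex.
have [c' [g' [Hc' Ec' <-]]] := aut_coherent Ab.
have := cycred_conj (cycle_flatten_nseq n.+1 Hc) (cycle_flatten_nseq n.+1 Hc').
move/(_ (g' * g^-1)); rewrite !wd_flatten_nseq conjgM !conjXg -Ec' -conjXg -E Ec conjXg.
rewrite conjgK => /(_ erefl).
rewrite !size_flatten /shape !map_nseq !sumn_nseq => /eqP.
by rewrite eqn_mul2r => /eqP.
Qed.

(** A leading letter of [g] on [gx] is removed by a conjugation that fixes [gx]; a trailing letter
    on [gy] commutes with [gy]. A trimmed nontrivial [g] is refuted by the primitive element
    [gx * gy]. *)
Lemma fixed_x_conj_y f g : is_endo f -> preserves_powers f ->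
  f gx = gx -> f gy = gy ^ g^-1 -> is_aut f.
Proof.
have [k] := ubnP (len g); elim: k f g => // k IH f g Hk Ef Hf Ex Ey.
case E : (val g) => [|l s].
  have {E} g1 : g = 1 by apply: val_inj; rewrite E.
  apply: aut_ext aut_id => x; symmetry.
  by apply: (endo_ext (h := id)) => //; rewrite Ey g1 invg1 conjg1.
have Ss : (size s < k)%N by move: Hk; rewrite /len E.
have [Hl|/negbTE Hl] := boolP l.1; last first.
  have Hgl : gx ^ gl l = gx.
    by rewrite gl_sg Hl /sg conjgE; case: l.2; rewrite ?mulKg // mulgV mulg1 invgK.
  apply: (aut_Kcomp (aut_conj (gl l))); apply: (IH _ (wd s)).
  - exact: leq_ltn_trans (len_wd s) Ss.
  - exact: endo_comp (endo_conj _) Ef.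
  - exact: preserves_powers_compl (aut_conj _) Hf.
  - by rewrite /= Ex.
  - by rewrite /= Ey -conjgM -(wd_val g) E wd_cons invgM mulgVK.
have [Hm|Hm] := boolP (last l s).1.
  have Hgl : gy ^ (gl (last l s))^-1 = gy.
    by rewrite gl_sg Hm /sg conjgE; case: _.2; rewrite ?invgK ?mulKg // mulgV mulg1.
  apply: (IH _ (wd (belast l s))) => //.
    by apply: leq_ltn_trans (len_wd _) _; rewrite size_belast.
  by rewrite Ey -(wd_val g) E lastI wd_rcons invgM conjgM Hgl.
(* Now [g] starts on [gy] and ends on [gx], so [gx * g * gy * g^-1] is cyclically reduced as
   written, whereas its exponent sums (1, 1) impose length 2. *)
pose W : seq letter := ((false, false) :: l :: s) ++ (true, false) :: swinv (l :: s).
have HW : cycred W.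
  have Hred : sorted nocancel (l :: s) by rewrite -E; apply: val_reduced.
  have HKl : last (true, false) (swinv (l :: s)) = linv l.
    by rewrite swinv_cons last_rcons.
  have HKp : path nocancel (true, false) (swinv (l :: s)).
    have := Hred; rewrite -sorted_swinv lastI swinv_rcons /= => ->.
    by rewrite andbT; move: Hm; case: (last l s) => [[] []].
  rewrite /W; move: (swinv _) HKl HKp => K HKl HKp.
  rewrite /cycred /= rcons_cat cat_path /= rcons_path HKl HKp; move: Hred => /= ->.
  by move: Hl Hm; case: (l) (last l s) => [[] []] [[] []].
have EW : f (gx * gy) = wd W.
  rewrite (endoM Ef) Ex Ey /W wd_cat wd_cons -mulgA; congr (_ * _).
  by rewrite conjgE invgK -E wd_cons wd_swinv wd_val.
have [_ [c [h [_ _ Hc Ec Sc]]]] := preserves_powers_coherent Hf aut_mul.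
rewrite hom_gx EW in Ec; have := cycred_conj HW Hc Ec.
have -> : size c = 2 by rewrite Sc hom_gx (endoM Ef) Ex Ey !(exM _ gx) !exJ.
by rewrite /W size_cat /= size_swinv !addnS.
Qed.

(** Composition with automorphisms normalises [f] in stages: [f gx] has the same power as [gx], then
    [f gx = gx], then [f gy] has exponent sum zero in [gx], then [f gy] is a conjugate of [gy]. *)
Lemma preserves_powers_aut f : is_endo f -> preserves_powers f -> is_aut f.
Proof.
move=> Ef Hf; have [h Ah Eh] := Hf _ aut_id.
have [k Ak [hK _]] := aut_inv Ah.
apply: (aut_Kcomp Ak); move: (preserves_powers_compl Ak Hf) (endo_comp (proj1 Ak) Ef).
have Ek : (k \o f) gx ^+ n.+1 = gx ^+ n.+1.
  by rewrite /= -(endoX (proj1 Ak)) Eh (endoX (proj1 Ak)) hK.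
move: (k \o f) Ek => {h Ah Eh k Ak hK Ef Hf} {}f Efx Hf Ef.
have [_ [c [g [_ _ _ Ec Sc]]]] := preserves_powers_coherent Hf aut_id.
rewrite !(exX_inj _ Efx) in Sc.
have Ecx i : ab i c = ex i gx by rewrite -ex_wd -(exJ i _ g) -Ec (exX_inj i Efx).
case: c Sc Ec Ecx => [|l [|? ?]] //= _ Ec Ecx.
have {Ecx} El : l = (false, false).
  by move: (Ecx false) (Ecx true); case: (l) => [[] []].
apply: (aut_Kcomp (aut_conj g^-1)).
move: (preserves_powers_compl (aut_conj g^-1) Hf) (endo_comp (endo_conj g^-1) Ef).
have Efx' : (conjg^~ g^-1 \o f) gx = gx by rewrite /= Ec conjgK El.
move: (conjg^~ g^-1 \o f) Efx' => {g l Ec El Efx Hf Ef} {}f Efx Hf Ef.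
(* The sign of [l] and the exponent [m] cancel the exponent sum of [f gy] in [gx]. *)
have [l [m [Hl Em]]] : exists l (m : nat), l.1 = false /\ ex false (f gy * gl l ^+ m) = 0%R.
  exists (false, (0 <= ex false (f gy))%R), `|ex false (f gy)|%N; split=> //.
  by rewrite exM exX; case: (ex false (f gy)) => i /=; rewrite /ex /= /wt /=; lia.
have Asw := aut_swap; have Ash := aut_shear m Hl.
apply: (aut_compK Ash).
move: (preserves_powers_compr Ash Hf) (endo_comp Ef (proj1 Ash)).
have Efx' : (f \o hom gx (gy * gl l ^+ m)) gx = gx by rewrite /= hom_gx.
have Efy : ex false ((f \o hom gx (gy * gl l ^+ m)) gy) = 0%R.
  rewrite /= hom_gy (endoM Ef) (endoX Ef) -[RHS]Em; congr (ex _ (_ * _ ^+ _)).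
  by rewrite gl_sg Hl; case: l.2; rewrite /sg ?(endoV Ef) Efx.
move: (f \o _) Efx' Efy => {l m Hl Em Ash Efx Hf Ef} {}f Efx Efy Hf Ef.
have [b [c [g [Ab Eb _ Ec Sc]]]] := preserves_powers_coherent Hf Asw.
rewrite hom_gx in Eb Ec Sc.
(* The primitive [b gx] has exponent sums (0, t), and the inverse of [b] takes it to [gx], so t
   divides 1. *)
have Et : `|ex true (f gy)|%N = 1%N.
  have [k [Ek _] [bK _]] := aut_inv Ab.
  have := ex_endo false (b gx) Ek; rewrite bK -!Eb Efy GRing.mul0r GRing.add0r.
  move=> /(congr1 absz); rewrite abszM => /esym/eqP.
  by rewrite muln_eq1 => /andP[/eqP].
rewrite Efy Et /= in Sc.
case: c Sc Ec => [|l [|? ?]] //= _ Ec.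
have Hl : l.1 = true.
  by move: Efy; rewrite Ec exJ; case: (l) => [[] []].
have Ahl : is_aut (hom gx (gl l)) by apply: aut_letters; rewrite Hl.
apply: (aut_compK Ahl); apply: (@fixed_x_conj_y _ g^-1).
- exact: endo_comp Ef (hom_endo _ _).
- exact: preserves_powers_compr.
- by rewrite /= hom_gx.
rewrite /= hom_gy invgK gl_sg Hl; move: Ec; rewrite -[wd [:: l]]/(gl l) gl_sg Hl.
by case: l.2 => //=; rewrite (endoV Ef) => ->; rewrite conjVg invgK.
Qed.

End PrimitivePowers.

(** * Exponent sums along the orbit, minimal words and the conclusion *)

(** Euclidean algorithm: the swap makes the second exponent sum the smaller in absolute value, and a
    shear then decreases the first. *)
Lemma orbit_ex_true0 u : exists2 v, aut_orbit u v & ex true v = 0%R.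
Proof.
have [n] := ubnP (`|ex false u| + `|ex true u|)%N; elim: n u => // n IH u Hn.
have [Ey|Ny] := eqVneq (ex true u) 0%R; first by exists u => //; apply: orbit_refl.
have swapE i v : ex i (hom gy gx v) = ex (~~ i) v.
  rewrite (ex_endo i v (hom_endo _ _)) hom_gx hom_gy; case: i.
    by rewrite GRing.mulr1 GRing.mulr0 GRing.addr0.
  by rewrite GRing.mulr1 GRing.mulr0 GRing.add0r.
have [Ex|Nx] := eqVneq (ex false u) 0%R.
  exists (hom gy gx u); last by rewrite swapE.
  by apply: orbit_aut aut_swap _; apply: orbit_refl.
wlog Hle : u Hn Nx Ny / (`|ex true u| <= `|ex false u|)%N.
  move=> W; have [/W|/ltnW Hlt] := leqP `|ex true u|%N `|ex false u|%N; first exact.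
  have [||||v Hv Ev] := W (hom gy gx u); rewrite ?swapE //; first by rewrite addnC.
  exists v => //; apply: orbit_trans Hv; apply: orbit_aut aut_swap _; exact: orbit_refl.
have shearE i (e : bool) :
    ex i (hom gx (gy * gl (false, e) ^+ 1) u) =
    (ex i u + (if i then 0 else if e then - ex true u else ex true u))%R.
  rewrite (ex_endo i u (hom_endo _ _)) hom_gx hom_gy exM.
  by case: i e => [] []; rewrite /= ?GRing.mulr1 ?GRing.mulr0 ?GRing.mulrN1 ?GRing.add0r ?GRing.addr0.
pose e := ((0 <= ex true u) == (0 <= ex false u))%R.
have [|v Hv Ev] := IH (hom gx (gy * gl (false, e) ^+ 1) u).
  rewrite !shearE /e; move: (ex false u) (ex true u) Hn Nx Ny Hle => p q.
  by case: ifP; lia.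
exists v => //; apply: orbit_trans Hv; apply: orbit_aut (orbit_refl _); exact: aut_shear.
Qed.

(** [i] and [j] count the occurrences of x2 and of its inverse; two natural exponents stand in for
    an integer power. *)
Lemma hom1_powers d w : exists i j : nat,
  hom 1 d w = d ^+ i * d^-1 ^+ j /\ ex true w = (i%:Z - j%:Z)%R.
Proof.
rewrite -(wd_val w) ex_wd hom_wd; elim: (val w) => [|l s [i [j [E1 E2]]]] /=.
  by exists 0, 0; rewrite mulg1.
case: l => [[] []]; rewrite /ev /wt /= E1 E2.
- exists i, j.+1; rewrite [_ ^+ j.+1]expgS !mulgA; split; last by lia.
  congr (_ * _); apply: commuteX; apply: commute_sym.
  exact: commuteV (commute_refl d).
- by exists i.+1, j; rewrite expgS mulgA; split=> //; lia.
- by exists i, j; rewrite invg1 mul1g GRing.add0r.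
- by exists i, j; rewrite mul1g GRing.add0r.
Qed.

Lemma hom1_ex_true0 d w : ex true w = 0%R -> hom 1 d w = 1.
Proof.
have [i [j [-> ->]]] := hom1_powers d w => /eqP; rewrite GRing.subr_eq0 => /eqP[->].
by rewrite expVgn mulgV.
Qed.

Lemma orbit_min_cycred u : exists w : seq letter, [/\ cycred w, aut_orbit u (wd w) &
  forall w' : seq letter, cycred w' -> aut_orbit u (wd w') -> size w <= size w'].
Proof.
have [w0 [g [Hw0 Eu]]] := cycred_rep u.
have : aut_orbit u (wd w0).
  have -> : wd w0 = u ^ g^-1 by rewrite Eu conjgK.
  exact: orbit_aut (aut_conj _) (orbit_refl _).
have [n] := ubnP (size w0); elim: n w0 Hw0 {g Eu} => // n IH w Hw Hn Ow.
have [[w' [Hw' Ow' Hlt]]|Hmin] := classic (exists w' : seq letter,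
    [/\ cycred w', aut_orbit u (wd w') & size w' < size w]).
  by apply: (IH w') => //; apply: leq_trans Hlt _.
exists w; split=> // w' Hw' Ow'; rewrite leqNgt; apply/negP => Hlt.
by apply: Hmin; exists w'.
Qed.

Theorem theorem1p1 (u : F2) (phi : F2 -> F2) :
  u <> F2one ->
  is_endo phi ->
  (forall v, aut_orbit u v -> aut_orbit u (phi v)) ->
  is_aut phi.
Proof.
move=> u1 Ephi Hphi.
have [w0 [Hw0 Ow0 Hmin]] := orbit_min_cycred u.
(* As [phi u] lies in the orbit, an automorphism [a] takes it to the element of minimal cyclic
   length. *)
have [a Aa Ea] : exists2 a, is_aut a & a (phi u) = wd w0.
  have [a [Aa E]] := orbit_trans (orbit_sym (Hphi u (orbit_refl u))) Ow0.
  by exists a.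
have Ef : is_endo (a \o phi) by apply: endo_comp Ephi; case: Aa.
apply: (aut_Kcomp Aa).
have [c [d [Hcd Hn]]] := nielsen_normal (a (phi gx)) (a (phi gy)).
have [beta Ab [g Eg]] := nielsen_aut Hcd.
have {Hcd} Ecd w : hom c d w = a (phi (beta w)) ^ g.
  by rewrite Eg; congr (_ ^ _); symmetry; apply: (endo_hom Ef).
have Horb v : aut_orbit u v -> aut_orbit u (hom c d v).
  move=> Ov; rewrite Ecd; apply: orbit_aut (aut_conj _) _; apply: orbit_aut Aa _.
  by apply: Hphi; apply: orbit_aut.
case: Hn => [c1|[e1 [e2 [Ec Ed]]]|Hexp].
(* Trivial entry: some [v] in the orbit has second exponent sum zero and is sent to 1, which forces
   [u = 1]. *)
- have [v Ov Ev] := orbit_ex_true0 u.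
  have := Horb v Ov; rewrite c1 hom1_ex_true0 // => /orbit_sym[h [[Eh _] Eu]].
  by case: u1; rewrite Eu (endo1 Eh).
- apply: (aut_compK Ab); apply: (aut_Kcomp (aut_conj g)).
  apply: (aut_ext (f := hom c d)) => [x|]; first by rewrite Ecd.
  by rewrite Ec Ed; apply: aut_letters.
(* Expanding pair: [w] represents the preimage of [u] under [beta], so its image is conjugate to
   [wd w0]. Then |w0| <= |w| <= |z| = |w0|, and [w] is powerlike. *)
have [k Ak [bK kK]] := aut_inv Ab.
have [w [h [Hw Ew]]] := cycred_rep (k u).
have Ow : aut_orbit u (wd w).
  have -> : wd w = k u ^ h^-1 by rewrite Ew conjgK.
  exact: orbit_aut (aut_conj _) (orbit_aut Ak (orbit_refl _)).
have w_neq0 : w <> [::].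
  move=> w0E; move: Ow; rewrite w0E wd0 => /orbit_sym[f [[Eff _] Eu]].
  by case: u1; rewrite Eu (endo1 Eff).
have [z [g' [Hz Ez Hle Heq]]] := Hexp w w_neq0 Hw.
have {}Ez : wd z = wd w0 ^ (g * (hom c d h)^-1 * g').
  rewrite !conjgM -Ea -{1}(kK u) -Ecd -conjgM Ez Ew (endoJ (hom_endo _ _)).
  by rewrite conjgM conjgK.
have Sz := cycred_conj Hz Hw0 Ez.
have /Heq Hpow : size w = size z.
  by apply/eqP; rewrite eqn_leq Hle Sz Hmin.
have [n [f [Af Ewn]]] := powerlike_pow w_neq0 Hw Hpow.
(* The orbit of [u] consists of the powers of exponent [n.+1] of primitive elements, so [phi] itself
   satisfies [preserves_powers]. *)
apply: aut_comp Aa _; apply: (@preserves_powers_aut n) => // b Abb.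
have Opow f' : is_aut f' -> aut_orbit u (f' gx ^+ n.+1).
  move=> Af'; rewrite -(endoX (proj1 Af')); apply: orbit_aut => //.
  apply: orbit_trans Ow _; rewrite Ewn -(endoX (proj1 Af)).
  exact/orbit_sym/(orbit_aut Af)/orbit_refl.
have Ob := Hphi _ (Opow b Abb); rewrite (endoX Ephi) in Ob.
have [q [Aq Eq]] := orbit_trans (orbit_sym (Opow _ aut_id)) Ob.
by exists q => //; rewrite Eq (endoX (proj1 Aq)).
Qed.
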